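(* Let $M$ be the diffeological space of all polynomials from $\mathbb{R}$ to $\mathbb{R}$ and let $x\in M$. Then the tangent space at $x$ in $M$ is given by $$T_xM\simeq C_xM\simeq\mathbb{R}^\infty,$$ where $\simeq$ means diffeomorphic as diffeological spaces.
   Context: A diffeological space is a non-empty set $X$ with a set of parametrizations (continuous maps $U\to X$, $U\subset\mathbb{R}^n$ open), called plots, containing constant ones, closed under locality and under precomposition with smooth maps between open subsets of Euclidean spaces. A map is smooth if it carries plots to plots by composition; a diffeomorphism is a smooth bijection with smooth inverse. $C^\infty(X,Y)$ is the set of smooth maps $X\to Y$ with the functional diffeology: $p\colon U\to C^\infty(X,Y)$ is a plot iff $(u,x)\mapsto p(u)(x)$ is smooth on $U\times X$. $M$ is the set of real polynomial functions in one real variable; $M_n\subset M$ is the set of those of degree $\le n$, identified via coefficients with $\mathbb{R}^{n+1}$ (with its usual topology and diffeology). $M$ carries the final topology with respect to the inclusions $M_n\to M$ (the finest topology making all of them continuous), and the subset diffeology inherited from the functional diffeology of $C^\infty(\mathbb{R},\mathbb{R})$, where parametrizations are required to be continuous: thus $p\colon U\to M$ is a plot iff it is continuous for the final topology and $(u,y)\mapsto p(u)(y)$ is smooth on $U\times\mathbb{R}$. For a diffeological space $X$ and $x\in X$: $\mathrm{Paths}_x(X)=\{\alpha\in C^\infty(\mathbb{R},X)\mid\alpha(0)=x\}$ with the subset diffeology of the functional diffeology; $\mathrm{d}_\alpha\colon C^\infty(X,\mathbb{R})\to\mathbb{R}$, $\mathrm{d}_\alpha(f)=\frac{\partial}{\partial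 u}f(\alpha(u))|_{u=0}$; $\alpha\sim\beta$ iff the tangent maps at $0$ agree, i.e. $\mathrm{d}_{\alpha\circ\delta}=\mathrm{d}_{\beta\circ\delta}$ for all $\delta\in\mathrm{Paths}_0(\mathbb{R})$. The tangent cone is $C_xX=\{\mathrm{d}_\alpha\mid\alpha\in\mathrm{Paths}_x(X)/{\sim}\}$; its plots are the maps locally of the form $u\mapsto\mathrm{d}_{q(u)}$ with $q$ a plot of the quotient $\mathrm{Paths}_x(X)/{\sim}$ (i.e. $q$ lifts locally to a plot of $\mathrm{Paths}_x(X)$). The tangent space is $T_xX=\mathrm{span}(C_xX)$, the real linear span, with the weak diffeology: plots are locally of the form $u\mapsto\sum_{i=1}^n\lambda_i(u)p_i(u)$ with $\lambda_i$ smooth real-valued and $p_i$ plots of $C_xX$. $\mathbb{R}^\infty=\bigcup_n\mathbb{R}^n$ is the space of finitely supported real sequences, where $\mathbb{R}^n\subset\mathbb{R}^{n+1}$ via $v\mapsto(v,0)$, with the diffeology whose plots are the maps that locally take values in some $\mathbb{R}^n$ and are smooth there in the usual sense (the fine diffeology). *)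

(* Defs.v *)
From HB Require Import structures.
From mathcomp Require Import all_boot all_order all_algebra.
From mathcomp Require Import all_classical all_reals.
From mathcomp Require Import topology normedtype landau derive.

Set Implicit Arguments.
Unset Strict Implicit.
Unset Printing Implicit Defensive.

Import Order.TTheory GRing.Theory Num.Theory.
Import numFieldNormedType.Exports.

Local Open Scope classical_set_scope.
Local Open Scope ring_scope.

Section Smooth.
Context {R : realType}.
Implicit Types V W : normedModType R.

(* [Ck k U f] is the usual notion for U open and V finite-dimensional (the only
   case used): f is k times continuously Frechet differentiable on U. *)
Fixpoint Ck V W (k : nat) (U : set V) (f : V -> W) : Prop :=
  if k is k'.+1 then
    {in U, forall x, differentiable f x} /\
    forall v : V, Ck k' U (fun x => 'd f x v)
  else {in U, continuous f}.

Definition smooth_on V W (U : set V) (f : V -> W) := forall k, Ck k U f.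

Lemma near_eq_diff V W (f g : V -> W) (x : V) :
  (\forall y \near x, f y = g y) -> differentiable f x ->
  differentiable g x /\ 'd g x = 'd f x :> (V -> W).
Proof.
move=> fg df.
have fgx : f x = g x by exact: nbhs_singleton fg.
have dE : g \o shift x = cst (g x) + 'd f x +o_ 0 id.
  apply/eqaddoP => e e0.
  have /eqaddoP /(_ e e0) := diff_locally df.
  have fg0 : \forall h \near (0 : V), f (h + x) = g (h + x).
    by move: fg; rewrite (near_shift 0); apply: filterS => y /=; rewrite subr0.
  apply: filterS2 fg0 => h /= fgh.
  by rewrite -![(_ + _) h]/(_ + _) -![(- _) h]/(- _) /= fgh fgx.
have dgE := diff_unique (diff_continuous df) dE.
split=> //; apply/diff_locallyP; rewrite dgE; split=> //.
exact: diff_continuous.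
Qed.

Lemma open_near_eq V (T : Type) (U : set V) (f g : V -> T) (x : V) :
  open U -> {in U, f =1 g} -> x \in U -> \forall y \near x, f y = g y.
Proof.
move=> oU fg /set_mem Ux.
have : \forall y \near x, U y by exact: open_nbhs_nbhs.
by apply: filterS => y /mem_set; exact: fg.
Qed.

Lemma continuous_in_eq V (T : topologicalType) (U : set V) (f g : V -> T) :
  open U -> {in U, f =1 g} -> {in U, continuous f} -> {in U, continuous g}.
Proof.
move=> oU fg fc x Ux; have nfg := open_near_eq oU fg Ux.
rewrite /continuous_at -(fg _ Ux).
by apply: cvg_trans (fc x Ux); apply: near_eq_cvg.
Qed.

Lemma Ck_ext V W k (U : set V) (f g : V -> W) :
  open U -> {in U, f =1 g} -> Ck k U f -> Ck k U g.
Proof.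
move=> oU; elim: k f g => [|k IH] f g fg /=.
  exact: continuous_in_eq.
move=> [df dfC].
have dg x : x \in U -> differentiable g x /\ 'd g x = 'd f x :> (V -> W).
  by move=> Ux; apply: near_eq_diff (df x Ux); exact: open_near_eq fg Ux.
split=> [x Ux|v]; first by have [] := dg x Ux.
by apply: IH (dfC v) => x Ux; have [_ ->] := dg x Ux.
Qed.

Lemma CkW V W k (U : set V) (f : V -> W) : Ck k.+1 U f -> Ck k U f.
Proof.
elim: k f => [|k IH] f [df dfC]; last by split=> // v; exact/IH/dfC.
by move=> x Ux; exact/differentiable_continuous/df.
Qed.

Lemma Ck_sub V W k (U U' : set V) (f : V -> W) :
  U' `<=` U -> Ck k U f -> Ck k U' f.
Proof.
move=> sU; have sU' x : x \in U' -> x \in U.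
  by move=> /set_mem /sU /mem_set.
elim: k f => [|k IH] f /=; first by move=> fc x /sU'; exact: fc.
by case=> df dfC; split=> [x /sU'|v]; [exact: df|exact/IH/dfC].
Qed.

Lemma Ck_local V W k (U : set V) (f : V -> W) :
  (forall x, U x -> exists U', U' x /\ Ck k U' f) -> Ck k U f.
Proof.
elim: k f => [|k IH] f loc /=.
  move=> x /set_mem /loc [U' [U'x fc]]; apply: fc; exact: mem_set.
split=> [x /set_mem /loc [U' [U'x [df _]]]|v].
  by apply: df; exact: mem_set.
apply: IH => x /loc [U' [U'x [_ dfC]]]; exists U'; split=> //; exact: dfC.
Qed.

Lemma Ck_cst V W k (U : set V) (a : W) : Ck k U (fun _ : V => a).
Proof.
elim: k a => [|k IH] a /=; first by move=> x _; exact: cvg_cst.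
split=> [x _|v]; first exact: differentiable_cst.
suff -> : (fun x : V => 'd (fun _ => a) x v) = (fun _ => 0) by exact: IH.
by apply/funext => x; rewrite (@diff_cst _ V W a x).
Qed.

Lemma Ck_id V k (U : set V) : Ck k U (@id V).
Proof.
elim: k => [|k IH] /=; first by move=> ? _; exact: cvg_id.
split=> [x _|v]; first exact: ex_diff.
suff -> : (fun x : V => 'd id x v) = (fun=> v) by exact: Ck_cst.
by apply/funext => x; rewrite diff_val.
Qed.

Lemma CkD V W k (U : set V) (f g : V -> W) : open U ->
  Ck k U f -> Ck k U g -> Ck k U (f + g).
Proof.
move=> oU; elim: k f g => [|k IH] f g /=.
  by move=> fc gc x Ux; apply: continuousD; [exact: fc|exact: gc].
move=> [df dfC] [dg dgC]; split=> [x Ux|v].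
  by apply: differentiableD; [exact: df|exact: dg].
apply: Ck_ext (IH _ _ (dfC v) (dgC v)) => // x Ux.
by rewrite diffD //; [exact: df|exact: dg].
Qed.

Lemma Ck_sum V W k (U : set V) n (f : 'I_n -> V -> W) : open U ->
  (forall i, Ck k U (f i)) -> Ck k U (\sum_(i < n) f i).
Proof.
move=> oU fC; elim/big_ind: _ => //; first exact: (@Ck_cst V W k U 0).
by move=> g h; exact: CkD.
Qed.

Lemma Ck_mx V m n k (U : set V) (f : V -> 'M[R]_(m, n)) i j : open U ->
  Ck k U f -> Ck k U (fun x => f x i j : R).
Proof.
move=> oU; elim: k f => [|k IH] f /=.
  move=> fc x Ux; apply: (@continuous_comp _ _ _ f (fun M => M i j)).
    exact: fc.
  exact: coord_continuous.
move=> [df dfC].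
have @L : {linear 'M[R]_(m, n) -> R}.
  by exists (fun N : 'M[R]_(_, _) => N i j); do 2![eexists]; do ?[constructor];
     rewrite ?mxE// => ? *; rewrite ?mxE//; move=> ?; rewrite !mxE.
have Lc : continuous L by exact: coord_continuous.
split=> [x Ux|v].
  apply: (@differentiable_comp _ _ _ _ f L); first exact: df.
  exact: linear_differentiable.
apply: Ck_ext (IH _ (dfC v)) => // x Ux.
have dL : differentiable L (f x) by exact: linear_differentiable.
have -> : (fun x => f x i j : R) = L \o f by [].
by rewrite (diff_comp (df x Ux) dL) /= (diff_lin (f x) Lc).
Qed.

Lemma CkM V k (U : set V) (f g : V -> R) : open U ->
  Ck k U f -> Ck k U g -> Ck k U (f * g).
Proof.
move=> oU; elim: k f g => [|k IH] f g /=.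
  by move=> fc gc x Ux; apply: continuousM; [exact: fc|exact: gc].
move=> fC gC; have [f0 g0] := (CkW fC, CkW gC).
case: fC gC => [df dfC] [dg dgC]; split=> [x Ux|v].
  by apply: differentiableM; [exact: df|exact: dg].
apply: Ck_ext (CkD oU (IH _ _ f0 (dgC v)) (IH _ _ g0 (dfC v))) => // x Ux.
by rewrite diffM //; [exact: df|exact: dg].
Qed.

Lemma Ck_scalel V W k (U : set V) (s : V -> R) (w : W) : open U ->
  Ck k U s -> Ck k U (fun x => s x *: w).
Proof.
move=> oU; elim: k s => [|k IH] s /=.
  by move=> sc x Ux; apply: continuousZr_tmp; exact: sc.
move=> [ds dsC]; split=> [x Ux|v]; first exact/differentiableZl/ds.
by apply: Ck_ext (IH _ (dsC v)) => // x Ux; rewrite diffZl //; exact: ds.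
Qed.

Lemma Ck_rV V n k (U : set V) (f : V -> 'rV[R]_n) : open U ->
  (forall j, Ck k U (fun x => f x ord0 j : R)) -> Ck k U f.
Proof.
move=> oU fC.
have -> : f = \sum_(j < n) (fun x => f x ord0 j *: delta_mx ord0 j).
  by apply/funext => x; rewrite fct_sumE [LHS]row_sum_delta.
by apply: Ck_sum => // j; exact: Ck_scalel.
Qed.

Lemma linear_rV_sum V n (L : {linear 'rV[R]_n -> V}) (w : 'rV[R]_n) :
  L w = \sum_(j < n) w ord0 j *: L (delta_mx ord0 j).
Proof.
rewrite {1}(row_sum_delta w) linear_sum.
by apply: eq_bigr => j _; rewrite linearZ.
Qed.

Lemma Ck_comp V n k (U : set V) (U' : set 'rV[R]_n) (h : V -> 'rV[R]_n)
    (f : 'rV[R]_n -> R) : open U -> U `<=` h @^-1` U' ->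
  Ck k U h -> Ck k U' f -> Ck k U (f \o h).
Proof.
move=> oU hU; have hU' x : x \in U -> h x \in U'.
  by move=> /set_mem /hU /mem_set.
elim: k f => [|k IH] f.
  by move=> hc fc x Ux; apply: continuous_comp; [exact: hc|exact/fc/hU'].
move=> hC fC; have h0 := CkW hC; case: hC fC => [dh dhC] [df dfC]; split.
  by move=> x Ux; apply: differentiable_comp; [exact: dh|exact/df/hU'].
move=> v.
apply: (@Ck_ext _ _ _ U (\sum_(j < n) ((fun x => 'd h x v ord0 j) *
    ((fun y => 'd f y (delta_mx ord0 j)) \o h)))) => //.
  move=> x Ux; rewrite (diff_comp (dh x Ux) (df _ (hU' _ Ux))) /= fct_sumE.
  exact/esym/linear_rV_sum.
apply: Ck_sum => // j; apply: CkM => //; first exact/Ck_mx/dhC.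
exact/IH/dfC.
Qed.

Lemma smooth_on_comp V n (U : set V) (U' : set 'rV[R]_n) (h : V -> 'rV[R]_n)
    (f : 'rV[R]_n -> R) : open U -> U `<=` h @^-1` U' ->
  smooth_on U h -> smooth_on U' f -> smooth_on U (f \o h).
Proof. by move=> oU hU hs fs k; exact: Ck_comp hU (hs k) (fs k). Qed.

Lemma smooth_on_comp_rV V n m (U : set V) (U' : set 'rV[R]_n)
    (h : V -> 'rV[R]_n) (f : 'rV[R]_n -> 'rV[R]_m) :
  open U -> open U' -> U `<=` h @^-1` U' ->
  smooth_on U h -> smooth_on U' f -> smooth_on U (f \o h).
Proof.
move=> oU oU' hU hs fs k; apply: Ck_rV => // j.
apply: (@Ck_comp V n k U U' h (fun y => f y ord0 j)) => //.
by apply: Ck_mx => //; exact: fs.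
Qed.

Lemma smooth_on_horner V (U : set V) (f : V -> R) (p : {poly R}) : open U ->
  smooth_on U f -> smooth_on U (fun u => p.[f u]).
Proof.
move=> oU fs k; elim/poly_ind: p => [|p c IH].
  by apply: Ck_ext (Ck_cst k U 0) => // u _; rewrite horner0.
apply: Ck_ext (CkD oU (CkM oU IH (fs k)) (Ck_cst k U c)) => // u _.
by rewrite hornerMXaddC.
Qed.

Lemma open_preimage V (T : topologicalType) (U : set V) (h : V -> T)
    (A : set T) :
  open U -> {in U, continuous h} -> open A -> open (U `&` h @^-1` A).
Proof.
move=> oU hc oA; rewrite openE => u [Uu Ahu].
apply: filterI; first exact: open_nbhs_nbhs.
by apply: hc; [exact: mem_set|exact: open_nbhs_nbhs].
Qed.

End Smooth.

Definition parametrizations (R : realType) (T : Type) :=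
  forall n, set 'rV[R]_n -> ('rV[R]_n -> T) -> Prop.

(* [plot U p] says that the restriction of p to U is a plot: p is total, but
   only its values on U matter, by [plot_eq]. *)
Record is_diffeology (R : realType) (T : Type) (plot : parametrizations R T) :
    Prop := IsDiffeology {
  plot_inhabited : inhabited T;
  plot_open : forall n (U : set 'rV[R]_n) p, plot n U p -> open U;
  plot_eq : forall n (U : set 'rV[R]_n) p q,
    {in U, p =1 q} -> plot n U p -> plot n U q;
  plot_cst : forall n (U : set 'rV[R]_n) x, open U -> plot n U (fun=> x);
  plot_local : forall n (U : set 'rV[R]_n) p,
    (forall u, U u -> exists V, [/\ V u, V `<=` U & plot n V p]) -> plot n U p;
  plot_comp : forall n m (U : set 'rV[R]_n) p (V : set 'rV[R]_m) h,
    plot n U p -> open V -> V `<=` h @^-1` U -> smooth_on V h ->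
    plot m V (p \o h) }.

Record diffSpace (R : realType) := DiffSpace {
  dcarrier :> Type;
  plot : parametrizations R dcarrier;
  diffP : is_diffeology plot }.

Lemma open_loc (R : realType) n (U : set 'rV[R]_n)
    (P : set 'rV[R]_n -> Prop) : (forall V, P V -> open V) ->
  (forall u, U u -> exists V, [/\ V u, V `<=` U & P V]) -> open U.
Proof.
move=> PO loc; rewrite openE => u /loc [V [Vu VU /PO oV]].
by apply: (filterS VU); exact: open_nbhs_nbhs.
Qed.

Section Locally.
Context {R : realType} {T : Type}.
Variable P : parametrizations R T.

Definition locally : parametrizations R T := fun n U p =>
  open U /\ forall u, U u -> exists V, [/\ open V, V u, V `<=` U & P V p].

Lemma locally_diffeology : inhabited T ->
  (forall n (U : set 'rV[R]_n) p q,
    open U -> {in U, p =1 q} -> P U p -> P U q) ->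
  (forall n (U : set 'rV[R]_n) x, open U -> P U (fun=> x)) ->
  (forall n m (U : set 'rV[R]_n) p (V : set 'rV[R]_m) h, open U -> P U p ->
    open V -> V `<=` h @^-1` U -> smooth_on V h -> P V (p \o h)) ->
  is_diffeology locally.
Proof.
move=> Tinh Peq Pcst Pcomp; split.
- exact: Tinh.
- by move=> n U p [].
- move=> n U p q pq [oU loc]; split=> // u /loc [V [oV Vu VU PV]].
  exists V; split=> //; apply: Peq oV _ PV => v /set_mem /VU /mem_set; exact: pq.
- by move=> n U x oU; split=> // u Uu; exists U; split=> //; exact: Pcst.
- move=> n U p loc; split.
    by apply: open_loc loc => V [].
  move=> u /loc [V [Vu VU [oV]]] /(_ u Vu) [V' [oV' V'u V'V PV']].
  by exists V'; split=> //; exact: subset_trans VU.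
- move=> n m U p V h [oU loc] oV hV hs; split=> // v Vv.
  have [U' [oU' U'hv U'U PU']] := loc _ (hV _ Vv).
  have oW : open (V `&` h @^-1` U') by apply: open_preimage => //; exact: (hs 0).
  exists (V `&` h @^-1` U'); split=> //.
  apply: (Pcomp _ _ U') => //.
  by move=> k; apply: Ck_sub (hs k) => ? [].
Qed.

End Locally.

Section Constructions.
Context {R : realType}.

Definition dsmooth (X Y : diffSpace R) (f : X -> Y) :=
  forall n (U : set 'rV[R]_n) (p : 'rV[R]_n -> X), plot U p -> plot U (f \o p).

Record smooth_map (X Y : diffSpace R) := SmoothMap {
  smooth_fun :> X -> Y;
  smooth_mapP : dsmooth smooth_fun }.

Definition diffeomorphic (X Y : diffSpace R) :=
  exists (f : smooth_map X Y) (g : smooth_map Y X), cancel f g /\ cancel g f.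

Lemma dsmooth_cst (X Y : diffSpace R) (y : Y) : dsmooth (fun _ : X => y).
Proof.
have [_ Xo _ _ _ _] := diffP X; have [_ _ _ Ycst _ _] := diffP Y.
by move=> n U p /Xo; exact: Ycst.
Qed.

Lemma dsmooth_id (X : diffSpace R) : dsmooth (@id X).
Proof. by []. Qed.

Lemma dsmooth_comp (X Y Z : diffSpace R) (g : smooth_map Y Z)
  (f : smooth_map X Y) : dsmooth (g \o f).
Proof. by move=> n U p /(smooth_mapP f) /(smooth_mapP g). Qed.

Definition smooth_cst X Y y := SmoothMap (@dsmooth_cst X Y y).

Definition smooth_id X := SmoothMap (@dsmooth_id X).

Definition smooth_compose X Y Z g f := SmoothMap (@dsmooth_comp X Y Z g f).

Definition real_plot : parametrizations R R := fun n U p =>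
  open U /\ smooth_on U p.

Lemma real_diffeology : is_diffeology real_plot.
Proof.
split.
- exact: inhabits 0.
- by move=> n U p [].
- move=> n U p q pq [oU ps]; split=> // k; exact: Ck_ext pq (ps k).
- by move=> n U x oU; split=> // k; exact: Ck_cst.
- move=> n U p loc; split; first by apply: open_loc loc => V [].
  move=> k; apply: Ck_local => u /loc [V [Vu _ [_ ps]]].
  by exists V; split=> //; exact: ps.
- move=> n m U p V h [oU ps] oV hV hs; split=> //; exact: smooth_on_comp hV _ _.
Qed.

Definition real_diff := DiffSpace real_diffeology.

(* Smoothness of (u, x) |-> p u x on U * X, spelled out through the plots
   v |-> (h v, q v) of the product: h is smooth into U, and q is a plot of X. *)
Definition functional_plot X Y : parametrizations R (smooth_map X Y) :=
  fun n U p => open U /\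
    forall m (V : set 'rV[R]_m) (h : 'rV[R]_m -> 'rV[R]_n) (q : 'rV[R]_m -> X),
      V `<=` h @^-1` U -> smooth_on V h -> plot V q ->
      plot V (fun v => p (h v) (q v)).

Lemma functional_diffeology X Y : is_diffeology (@functional_plot X Y).
Proof.
have [_ Xo Xeq _ _ Xcomp] := diffP X.
have [[y] Yo Yeq _ Yloc Ycomp] := diffP Y.
split.
- exact: inhabits (smooth_cst X y).
- by move=> n U p [].
- move=> n U p q pq [oU ps]; split=> // m V h r hV hs Vr.
  by apply: Yeq (ps m V h r hV hs Vr) => v /set_mem /hV /mem_set /pq ->.
- by move=> n U f oU; split=> // m V h q _ _; exact: (smooth_mapP f).
- move=> n U p loc; split; first by apply: open_loc loc => V [].
  move=> m V h q hV hs Vq; have oV := Xo _ _ _ Vq.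
  apply: Yloc => v Vv; have [U' [U'hv U'U [oU' ps]]] := loc _ (hV _ Vv).
  have oW : open (V `&` h @^-1` U') by apply: open_preimage => //; exact: (hs 0).
  exists (V `&` h @^-1` U'); split=> //.
  apply: ps => //.
    by move=> k; apply: Ck_sub (hs k) => ? [].
  apply: (Xcomp _ _ V q _ id) => //.
  by move=> k; exact: Ck_id.
- move=> n m U p V h [oU ps] oV hV hs; split=> // l W g q gW gs Wq.
  apply: (ps l W (h \o g) q) => //; first by move=> w /gW /hV.
  exact: smooth_on_comp_rV (Xo _ _ _ Wq) oV gW gs hs.
Qed.

Definition functional_diff X Y := DiffSpace (@functional_diffeology X Y).

Definition subset_plot (X : diffSpace R) (A : X -> Prop) :
  parametrizations R {x | A x} := fun n U p => plot U (fun u => sval (p u)).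

Lemma subset_diffeology (X : diffSpace R) (A : X -> Prop) :
  (exists x, A x) -> is_diffeology (@subset_plot X A).
Proof.
have [_ Xo Xeq Xcst Xloc Xcomp] := diffP X.
move=> [x Ax]; split.
- exact: inhabits (exist _ x Ax).
- by move=> n U p; exact: Xo.
- by move=> n U p q pq; apply: Xeq => u /pq ->.
- by move=> n U z; exact: Xcst.
- by move=> n U p; exact: Xloc.
- by move=> n m U p V h Up oV hV hs; exact: Xcomp Up oV hV hs.
Qed.

Definition subset_diff X A A0 := DiffSpace (@subset_diffeology X A A0).

Definition quotient_plot (X : diffSpace R) (Q : quotType X) :
  parametrizations R Q := locally (fun n U q =>
    exists p : 'rV[R]_n -> X,
      plot U p /\ {in U, forall u, q u = (\pi_Q (p u))%qT}).

Lemma quotient_diffeology (X : diffSpace R) (Q : quotType X) :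
  is_diffeology (@quotient_plot X Q).
Proof.
have [[x0] _ _ Xcst _ Xcomp] := diffP X.
apply: locally_diffeology.
- exact: inhabits (\pi_Q x0)%qT.
- move=> n U p q _ pq [r [Ur pr]]; exists r; split=> // u Uu.
  by rewrite -pq // pr.
- move=> n U x oU; exists (fun=> repr x); split; first exact: Xcst.
  by move=> u _; rewrite reprK.
- move=> n m U p V h oU [r [Ur pr]] oV hV hs; exists (r \o h); split.
    exact: Xcomp Ur oV hV hs.
  by move=> v /set_mem /hV /mem_set /pr.
Qed.

Definition quotient_diff X Q := DiffSpace (@quotient_diffeology X Q).

End Constructions.

Arguments real_diff : clear implicits.

Notation "''C^oo' ( X , Y )" := (functional_diff X Y)
  (at level 8, format "''C^oo' ( X ,  Y )").

Section Tangent.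
Context {R : realType}.
Variable X : diffSpace R.
Local Notation RR := (real_diff R).

Lemma paths_nonempty (x : X) : exists a : 'C^oo(RR, X), a 0 = x.
Proof. by exists (smooth_cst RR x). Qed.

Definition paths (x : X) : diffSpace R := subset_diff (paths_nonempty x).

Definition tangent_functional : Type := 'C^oo(X, RR) -> R.

Definition tangent_vector (a : 'C^oo(RR, X)) : tangent_functional :=
  fun f => derive1 (f \o a : R -> R) 0.

End Tangent.

Section TangentCone.
Context {R : realType}.
Variables (X : diffSpace R) (x : X).
Local Notation RR := (real_diff R).

(* Tangent maps at 0 of the paths a and b are compared on all the vectors of the
   tangent cone of R at 0. *)
Definition tangent_rel : rel {classic paths x} := fun a b =>
  `[< forall d : paths (0 : RR),
        tangent_vector (smooth_compose (sval a) (sval d)) =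
        tangent_vector (smooth_compose (sval b) (sval d)) >].

Lemma tangent_rel_refl : reflexive tangent_rel.
Proof. by move=> a; apply/asboolP. Qed.

Lemma tangent_rel_sym : symmetric tangent_rel.
Proof. by move=> a b; apply/asboolP/asboolP => ab d; rewrite ab. Qed.

Lemma tangent_rel_trans : transitive tangent_rel.
Proof.
move=> b a c /asboolP ab /asboolP bc; apply/asboolP => d; rewrite ab; exact: bc.
Qed.

Canonical tangent_equiv :=
  EquivRel tangent_rel tangent_rel_refl tangent_rel_sym tangent_rel_trans.

Definition path_classes : diffSpace R :=
  quotient_diff ({eq_quot tangent_equiv}%qT : quotType (paths x)).

Definition class_vector (q : path_classes) : tangent_functional X :=
  tangent_vector (sval (repr q : paths x)).

Lemma class_vectorE (a : paths x) :
  class_vector (\pi_({eq_quot tangent_equiv}) (a : {classic paths x}))%qT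
  = tangent_vector (sval a).
Proof.
rewrite /class_vector; set b := repr _.
have /eqmodP/asboolP/(_ (exist _ (smooth_id RR) erefl)) :
    (b = a %[mod {eq_quot tangent_equiv}])%qT by rewrite reprK.
by [].
Qed.

Definition tangent_cone_carrier : Type :=
  {phi : tangent_functional X | exists q : path_classes, phi = class_vector q}.

Definition tangent_cone_plot : parametrizations R tangent_cone_carrier :=
  locally (fun n U p => exists q : 'rV[R]_n -> path_classes,
    plot U q /\ {in U, forall u, sval (p u) = class_vector (q u)}).

Lemma tangent_cone_diffeology : is_diffeology tangent_cone_plot.
Proof.
have [[q0] _ _ Qcst _ Qcomp] := diffP path_classes.
apply: locally_diffeology.
- exact: inhabits (exist _ (class_vector q0) (ex_intro _ q0 erefl)).
- move=> n U p p' _ pp' [q [Uq pq]]; exists q; split=> // u Uu.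
  by rewrite -pp' // pq.
- move=> n U [phi [q phiq]] oU; exists (fun=> q); split=> //; exact: Qcst.
- move=> n m U p V h oU [q [Uq pq]] oV hV hs; exists (q \o h); split.
    exact: Qcomp Uq oV hV hs.
  by move=> v /set_mem /hV /mem_set /pq.
Qed.

Definition tangent_cone := DiffSpace tangent_cone_diffeology.

Definition tangent_space_carrier : Type :=
  {phi : tangent_functional X |
    exists n (l : 'I_n -> R) (c : 'I_n -> tangent_cone),
      phi = fun f => \sum_(i < n) l i * sval (c i) f}.

Definition tangent_space_plot : parametrizations R tangent_space_carrier :=
  locally (fun m U p => exists n (l : 'I_n -> 'rV[R]_m -> R)
      (c : 'I_n -> 'rV[R]_m -> tangent_cone),
    [/\ forall i, smooth_on U (l i), forall i, plot U (c i) &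
        {in U, forall u,
          sval (p u) = fun f => \sum_(i < n) l i u * sval (c i u) f}]).

Lemma tangent_space_diffeology : is_diffeology tangent_space_plot.
Proof.
have [[c0] _ _ Ccst _ Ccomp] := diffP tangent_cone.
apply: locally_diffeology.
- apply: inhabits; exists (fun f => \sum_(i < 0) 0 * sval c0 f).
  by exists 0, (fun=> 0), (fun=> c0).
- move=> m U p p' _ pp' [n [l [c [ls cs pE]]]]; exists n, l, c; split=> // u Uu.
  by rewrite -pp' // pE.
- move=> m U [phi [n [l [c phiE]]]] oU.
  exists n, (fun i _ => l i), (fun i _ => c i); split=> [i k|i|//]; first exact: Ck_cst.
  exact: Ccst.
- move=> m m' U p V h oU [n [l [c [ls cs pE]]]] oV hV hs.
  exists n, (fun i => l i \o h), (fun i => c i \o h); split=> [i|i|].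
  + exact: smooth_on_comp hV hs (ls i).
  + exact: Ccomp (cs i) oV hV hs.
  + by move=> v /set_mem /hV /mem_set /pE.
Qed.

Definition tangent_space := DiffSpace tangent_space_diffeology.

End TangentCone.

Section Polynomials.
Variable R : realType.
Local Notation RR := (real_diff R).

Definition is_polyfun (f : 'C^oo(RR, RR)) :=
  exists p : {poly R}, forall t : R, f t = p.[t].

Definition polyfun : Type := {f : 'C^oo(RR, RR) | is_polyfun f}.

Lemma dsmooth_horner (p : {poly R}) : dsmooth (fun t : RR => p.[t] : RR).
Proof.
by move=> n U f [oU fs]; split=> //; exact: smooth_on_horner.
Qed.

Definition polyfun_of (p : {poly R}) : polyfun :=
  exist _ (SmoothMap (dsmooth_horner p)) (ex_intro _ p (fun=> erefl)).

HB.instance Definition _ := gen_eqMixin polyfun.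
HB.instance Definition _ := gen_choiceMixin polyfun.

(* The final topology for the maps R^(n+1) -> M_n -> M; a row of coefficients
   (v_0, ..., v_n) is identified with the polynomial rVpoly v of degree <= n. *)
Definition polyfun_open (A : set polyfun) :=
  forall n, open [set v : 'rV[R]_n.+1 | A (polyfun_of (rVpoly v))].

Lemma polyfun_openT : polyfun_open setT.
Proof. by move=> n; exact: openT. Qed.

Lemma polyfun_openI : setI_closed polyfun_open.
Proof. by move=> A B Ao Bo n; exact: openI (Ao n) (Bo n). Qed.

Lemma polyfun_open_bigU (I : Type) (f : I -> set polyfun) :
  (forall i, polyfun_open (f i)) -> polyfun_open (\bigcup_i f i).
Proof. by move=> fo n; apply: bigcup_open => i _; exact: fo. Qed.

HB.instance Definition _ := isOpenTopological.Build polyfun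
  polyfun_openT polyfun_openI polyfun_open_bigU.

Definition polyfun_plot : parametrizations R polyfun := fun n U p =>
  {in U, continuous p} /\ subset_plot U p.

Lemma polyfun_diffeology : is_diffeology polyfun_plot.
Proof.
have P0 : exists f, is_polyfun f by exists (sval (polyfun_of 0)), 0.
have [[f0] So Seq Scst Sloc Scomp] := subset_diffeology P0.
split.
- exact: inhabits f0.
- by move=> n U p [_ /So].
- move=> n U p q pq [pc Up]; split; last exact: Seq pq Up.
  exact: continuous_in_eq (So _ _ _ Up) pq pc.
- by move=> n U f oU; split; [move=> u _; exact: cst_continuous|exact: Scst].
- move=> n U p loc; split.
    by move=> u /set_mem /loc [V [Vu _ [pc _]]]; apply: pc; exact: mem_set.
  by apply: Sloc => u /loc [V [Vu VU [_ Vp]]]; exists V.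
- move=> n m U p V h [pc Up] oV hV hs; split; last exact: Scomp Up oV hV hs.
  move=> v Vv; apply: continuous_comp; first exact: (hs 0).
  by apply: pc; move/set_mem: Vv => /hV /mem_set.
Qed.

Definition polynomial_space := DiffSpace polyfun_diffeology.

(* R^n inside R^oo is the set of the sequences vanishing from rank n on. *)
Definition Rinfty_carrier : Type :=
  {s : nat -> R | exists n, forall i, (n <= i)%N -> s i = 0}.

Definition Rinfty_plot : parametrizations R Rinfty_carrier :=
  locally (fun m U p => exists n,
    {in U, forall u i, (n <= i)%N -> sval (p u) i = 0} /\
    smooth_on U (fun u => \row_(i < n) sval (p u) i)).

Lemma Rinfty_diffeology : is_diffeology Rinfty_plot.
Proof.
apply: locally_diffeology.
- by apply: inhabits; exists (fun=> 0), 0.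
- move=> m U p p' oU pp' [n [pn ps]]; exists n; split.
    by move=> u Uu; rewrite -pp' //; exact: pn.
  by move=> k; apply: Ck_ext (ps k) => // u Uu; rewrite pp'.
- move=> n U [s [N sN]] oU; exists N; split=> [u _ /= i|]; first exact: sN.
  move=> k; exact: Ck_cst.
- move=> n m U p V h oU [N [pN ps]] oV hV hs; exists N; split.
    by move=> v /set_mem /hV /mem_set /pN.
  exact: smooth_on_comp_rV oV oU hV hs ps.
Qed.

Definition Rinfty := DiffSpace Rinfty_diffeology.

End Polynomials.

(* Main.v *)
(* A plot of polynomials has locally bounded degree, because a sequence of
   polynomials whose degrees tend to infinity is closed for the final topology;
   interpolation then turns the smoothness of the evaluations into that of the
   coefficients, so the plots of M are exactly those of R^oo. Hence a path a
   through x lies in some R^N near 0, and the chain rule there shows that its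
   tangent vector is that of the line t |-> x + t q, where q collects the
   derivatives at 0 of the coefficients of a. This q is read off the tangent
   vector by evaluating it at the coefficient functions of M, and the tangent
   vector depends linearly on q; so the cone is already a vector space,
   identified with R^oo. *)
Require Import Defs.
From mathcomp Require Import all_boot all_algebra all_reals.
From mathcomp Require Import all_order all_classical.
From mathcomp Require Import interval_inference topology normedtype derive.

Set Implicit Arguments.
Unset Strict Implicit.
Unset Printing Implicit Defensive.

Import Order.TTheory GRing.Theory Num.Theory.
Import numFieldNormedType.Exports.

Local Open Scope classical_set_scope.
Local Open Scope ring_scope.

(** * Locality of smoothness and directional derivatives *)

Section Smooth.
Context {R : realType}.

Lemma smooth_map_eq (X Y : diffSpace R) (a b : smooth_map X Y) :
  a =1 b -> a = b.
Proof.
case: a b => a aP [b bP] /= /funext ab; subst b.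
by rewrite (Prop_irrelevance aP bP).
Qed.

Lemma near_open_sub (V : normedModType R) (U A : set V) (u : V) :
  open U -> U u -> (\forall v \near u, A v) ->
  exists U', [/\ open U', U' u, U' `<=` U & U' `<=` A].
Proof.
move=> oU Uu uA; exists (U `&` A°).
split; [|split|by move=> v []|by move=> v [_ /interior_subset]] => //.
by apply: openI => //; exact: open_interior.
Qed.

Lemma smooth_on_local (V W : normedModType R) (U : set V) (f : V -> W) :
  (forall u, U u -> exists U', U' u /\ smooth_on U' f) -> smooth_on U f.
Proof.
move=> loc k; apply: Ck_local => u /loc[U' [U'u fs]].
by exists U'; split=> //; exact: fs.
Qed.

Lemma smooth_on_ext (V W : normedModType R) (U : set V) (f g : V -> W) :
  open U -> {in U, f =1 g} -> smooth_on U f -> smooth_on U g.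
Proof. by move=> oU fg fs k; exact: Ck_ext (fs k). Qed.

Lemma smooth_on_sub (V W : normedModType R) (U U' : set V) (f : V -> W) :
  U' `<=` U -> smooth_on U f -> smooth_on U' f.
Proof. by move=> sU fs k; exact: Ck_sub (fs k). Qed.

Lemma smooth_on_lincomb (V : normedModType R) (U : set V) n
    (l f : 'I_n -> V -> R) : open U ->
  (forall i, smooth_on U (l i)) -> (forall i, smooth_on U (f i)) ->
  smooth_on U (fun v => \sum_(i < n) l i v * f i v).
Proof.
move=> oU ls fs k.
apply: (@Ck_ext _ _ _ _ _ (\sum_(i < n) (l i * f i))) => //.
  by move=> v _; rewrite fct_sumE.
by apply: Ck_sum => // i; apply: CkM => //; [exact: ls|exact: fs].
Qed.

Lemma smooth_on_diff (V W : normedModType R) (U : set V) (f : V -> W) (e : V) :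
  smooth_on U f -> smooth_on U (fun x => 'd f x e).
Proof. by move=> fs k; have [_] := fs k.+1; apply. Qed.

(** The two difference quotients are the same function of the increment [h]. *)
Lemma derive1_line (V : normedModType R) (G : V -> R) (a e : V) (g : R -> R) :
  (forall t, g t = G (t *: e + a)) -> derive1 g 0 = 'D_e G a.
Proof.
move=> gE; rewrite /derive1 /derive.
suff -> : (fun h : R => h^-1 *: (g (h + 0) - g 0)) =
    fun h => h^-1 *: ((G \o shift a) (h *: e) - G a) by [].
by apply/funext => h; rewrite !gE addr0 scale0r add0r.
Qed.

End Smooth.

(** * Polynomial functions and their final topology *)

Section PolynomialSpace.
Context {R : realType}.
Local Notation RR := (real_diff R).
Local Notation M := (polynomial_space R).
Implicit Types q : {poly R}.

(** The difference has the distinct roots 0, 1, ..., n - 1 with n its size, too many unless it is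
    zero. *)
Lemma horner_inj q1 q2 : (forall t : R, q1.[t] = q2.[t]) -> q1 = q2.
Proof.
move=> q12; apply/eqP; rewrite -subr_eq0; apply/eqP.
apply: (@roots_geq_poly_eq0 _ _ [seq i%:R | i <- iota 0 (size (q1 - q2))]).
- by apply/allP => t _; rewrite rootE hornerD hornerN q12 subrr.
- by rewrite map_inj_uniq ?iota_uniq// => i j /eqP; rewrite eqr_nat => /eqP.
- by rewrite size_map size_iota.
Qed.

Definition poly_of (f : M) : {poly R} := projT1 (cid (svalP f)).

Lemma poly_ofE (f : M) t : sval f t = (poly_of f).[t].
Proof. exact: projT2 (cid (svalP f)) t. Qed.

Lemma poly_ofK : cancel poly_of (@polyfun_of R).
Proof.
move=> f; case: f (poly_ofE f) => f fP /= fE; apply: eq_exist.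
by apply: smooth_map_eq => t /=; rewrite fE.
Qed.

Lemma polyfun_ofK : cancel (@polyfun_of R) poly_of.
Proof. by move=> q; apply: horner_inj => t; rewrite -poly_ofE. Qed.

(* A sequence of polynomials whose degrees tend to infinity meets each [M_n] in
   a finite set, so it is closed for the final topology. *)
Lemma unbounded_size_open (s : nat -> M) :
  (forall k, (k < size (poly_of (s k)))%N) ->
  open [set f | forall k, f <> s k].
Proof.
move=> sk; change (polyfun_open [set f | forall k, f <> s k]) => n.
rewrite -closedC.
have -> : ~` [set v : 'rV[R]_n.+1 |
      [set f : M | forall k, f <> s k] (polyfun_of (rVpoly v))] =
    \bigcup_(k in `I_n.+1) [set v | rVpoly v = poly_of (s k)].
  apply/seteqP; split=> v /=.
    move=> /existsNP[k /contrapT sE]; exists k; last by rewrite -sE polyfun_ofK.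
    (* A row of length n + 1 gives a polynomial of size at most n + 1, which forces k < n + 1. *)
    by rewrite /= (leq_trans (sk k))// -sE polyfun_ofK size_poly.
  by case=> k _ /= vE; apply/existsNP; exists k; rewrite vE poly_ofK.
apply: closed_bigcup; first exact: finite_II.
move=> k _; apply: (accessible_finite_set_closed.1 _ _ _).
  exact/hausdorff_accessible/norm_hausdorff.
(* A row is determined by its polynomial, so each of these sets has at most one point. *)
apply: (@sub_finite_set _ _ [set poly_rV (poly_of (s k))]) => // v /= <-.
by rewrite rVpolyK.
Qed.

(** Otherwise points [w k] tend to [u] while the sizes of the [p (w k)] tend to infinity; the
    complement of these values is an open neighbourhood of [p u], against continuity. *)
Lemma near_size_poly_of (V : normedModType R) (p : V -> M) (u : V) :
  {for u, continuous p} ->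
  exists N, \forall v \near u, (size (poly_of (p v)) <= N)%N.
Proof.
move=> pc; apply: contrapT => /forallNP unb.
(* Asking for sizes above [N0] keeps the values [p (w k)] distinct from [p u]. *)
set N0 := size (poly_of (p u)).
have /choice[w wP] (k : nat) : exists v : V,
    ball u k.+1%:R^-1 v /\ (maxn k N0 < size (poly_of (p v)))%N.
  apply: contrapT => /forallNP wk; apply: (unb (maxn k N0)).
  have : \forall v \near u, ball u k.+1%:R^-1 v.
    by apply: near_ball; rewrite invr_gt0.
  by apply: filterS => v uv; rewrite leqNgt; apply/negP => vk; exact: (wk v).
pose A : set M := [set f | forall k, f <> p (w k)].
have oA : open A.
  apply: unbounded_size_open => k.
  by rewrite (leq_ltn_trans _ (wP k).2)// leq_maxl.
have Au : A (p u).
  move=> k pk; have := (wP k).2.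
  by rewrite -pk -/N0 ltnNge leq_maxr.
have /pc/nbhs_ballP[e /= e0 eA] : nbhs (p u) A by exact: open_nbhs_nbhs.
have [k _ kP] := near_infty_natSinv_lt (PosNum e0).
have /eA/(_ k) : ball u e (w k).
  by apply: le_ball (wP k).1; apply/ltW/(kP k) => /=.
exact.
Qed.

(** * Interpolation and the plots of M *)

Lemma coef_interpolation N i : exists c : 'I_N -> R,
  forall q, (size q <= N)%N -> q`_i = \sum_(j < N) c j * q.[j%:R].
Proof.
have [Ni|iN] := leqP N i.
  exists (fun=> 0) => q qN; rewrite nth_default ?(leq_trans qN)//.
  by rewrite big1// => j _; rewrite mul0r.
(* Evaluation at 0, ..., N - 1 multiplies coefficient rows by a Vandermonde matrix, invertible since
   the nodes are distinct; the weights are column [i] of its inverse. *)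
pose A : 'M[R]_N := Vandermonde N (\row_(j < N) j%:R).
have uA : A \in unitmx.
  rewrite unitmxE det_Vandermonde unitfE; apply/prodf_neq0 => j _.
  apply/prodf_neq0 => k jk; rewrite !mxE subr_eq0 eqr_nat.
  by rewrite gtn_eqF.
exists (fun j => invmx A j (Ordinal iN)) => q qN.
have evE : poly_rV q *m A = \row_(j < N) q.[j%:R].
  apply/rowP => j; rewrite !mxE (horner_coef_wide _ qN).
  by apply: eq_bigr => k _; rewrite !mxE.
have := congr1 (fun v => (v *m invmx A) 0 (Ordinal iN)) evE.
rewrite mulmxK// mxE /= => ->; rewrite mxE.
by apply: eq_bigr => j _; rewrite mxE mulrC.
Qed.

(** The form that plots of both M and R^oo take once their points are read as polynomials; it is the
    bridge between the two diffeologies. *)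
Definition poly_plot m (U : set 'rV[R]_m) (p : 'rV[R]_m -> {poly R}) :=
  [/\ open U, forall i, smooth_on U (fun u => (p u)`_i) &
      forall u, U u -> exists N, \forall v \near u, (size (p v) <= N)%N].

Lemma continuous_rVpoly n :
  continuous (fun v : 'rV[R]_n.+1 => polyfun_of (rVpoly v)).
Proof. by apply/continuousP => A oA; exact: (oA : polyfun_open A). Qed.

Lemma polynomial_plotP m (U : set 'rV[R]_m) (p : 'rV[R]_m -> M) :
  plot U p <-> poly_plot U (poly_of \o p).
Proof.
split=> [pU|[oU pc pN]].
  have oU := plot_open (Defs.diffP M) pU; case: pU => pc [_ ps].
  have pN u : U u -> exists N,
      \forall v \near u, (size (poly_of (p v)) <= N)%N.
    by move=> Uu; apply: near_size_poly_of; apply: pc; exact: mem_set.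
  split=> // i; apply: smooth_on_local => u Uu.
  have [N uN] := pN _ Uu; have [V [oV Vu VU VN]] := near_open_sub oU Uu uN.
  exists V; split=> //; have [c cE] := coef_interpolation N i.
  (* On [V], where the size is bounded, the coefficient is a fixed combination of evaluations at
     integers, each smooth by the functional diffeology. *)
  apply: (smooth_on_ext
    (f := fun v => \sum_(j < N) c j * sval (p v) j%:R)) => //.
    by move=> v /set_mem/VN/cE /= ->; apply: eq_bigr => j _; rewrite poly_ofE.
  apply: smooth_on_lincomb => // j; first by move=> k; exact: Ck_cst.
  have [] : real_plot V (fun v => sval (p v) j%:R); last by [].
  apply: (ps m V id (fun=> j%:R)) => //; first by move=> k; exact: Ck_id.
  by split=> // k; exact: Ck_cst.
(* For continuity, [p] is near [u] the continuous coefficient row [a] followed by the inclusion of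
   the polynomials of degree at most N. *)
split=> [u /set_mem Uu|].
  have [N uN] := pN _ Uu.
  pose a v := poly_rV (poly_of (p v)) : 'rV[R]_N.+1.
  have ac : {for u, continuous a}.
    apply: (@Ck_rV R _ _ 0 U a oU _ u); last exact: mem_set.
    move=> j; apply: Ck_ext (pc j 0) => // v _.
    by rewrite /a mxE.
  have pE : \forall v \near u, polyfun_of (rVpoly (a v)) = p v.
    apply: filterS uN => v vN.
    by rewrite /a poly_rV_K ?poly_ofK// ltnW.
  have : polyfun_of (rVpoly (a v)) @[v --> u] --> polyfun_of (rVpoly (a u)).
    exact: (continuous_comp ac (@continuous_rVpoly _ _)).
  rewrite (nbhs_singleton pE : polyfun_of (rVpoly (a u)) = p u).
  move=> fc; apply: cvg_trans fc; exact: (@near_eq_cvg _ _ (nbhs u) _ _ _ pE).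
split=> // n V h q hV hs [oV qs]; split=> //.
apply: smooth_on_local => v Vv; have [N uN] := pN _ (hV _ Vv).
have [W [oW Wv WU WN]] := near_open_sub oU (hV _ Vv) uN.
have oX : open (V `&` h @^-1` W) by apply: open_preimage => //; exact: (hs 0).
exists (V `&` h @^-1` W); split=> //.
(* With the size bounded by N nearby, evaluation is a sum of N terms, each a smooth coefficient
   times a power. *)
apply: (smooth_on_ext (f := fun w =>
    \sum_(i < N) (poly_of (p (h w)))`_i * q w ^+ i)) => //.
  move=> w /set_mem[Vw /WN /= wN].
  by rewrite poly_ofE (horner_coef_wide _ wN).
apply: smooth_on_lincomb => // i.
  apply: (smooth_on_comp (h := h) (f := fun u => (poly_of (p u))`_i)
    (U' := U)) => //.
    by move=> w [/hV].
  by apply: smooth_on_sub hs => w [].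
apply: (smooth_on_ext (f := fun w => ('X^i).[q w])) => //.
  by move=> w _; rewrite hornerXn.
by apply: smooth_on_horner => //; apply: smooth_on_sub qs => w [].
Qed.

(** * Finitely supported sequences as polynomials *)

Definition poly_of_seq (s : Rinfty R) : {poly R} :=
  \poly_(i < projT1 (cid (svalP s))) sval s i.

(** The choice of the truncation rank is immaterial, as [s] vanishes from it on. *)
Lemma coef_poly_of_seq s i : (poly_of_seq s)`_i = sval s i.
Proof.
rewrite coef_poly; case: cid => /= n sn.
by case: ltnP => // /sn ->.
Qed.

Lemma coef_finite_support q : exists n, forall i, (n <= i)%N -> q`_i = 0.
Proof. by exists (size q) => i; exact: nth_default. Qed.

Definition seq_of_poly (q : {poly R}) : Rinfty R :=
  exist _ (fun i => q`_i) (coef_finite_support q).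

Lemma seq_of_polyK : cancel seq_of_poly poly_of_seq.
Proof. by move=> q; apply/polyP => i; rewrite coef_poly_of_seq. Qed.

Lemma poly_of_seqK : cancel poly_of_seq seq_of_poly.
Proof.
move=> [s sP]; apply: eq_exist; apply/funext => i.
by rewrite coef_poly_of_seq.
Qed.

(** Taking values in one R^n near a point is a local bound on the size, and smoothness into R^n is
    that of the coordinates. *)
Lemma Rinfty_plotP m (U : set 'rV[R]_m) (p : 'rV[R]_m -> Rinfty R) :
  plot U p <-> poly_plot U (poly_of_seq \o p).
Proof.
split=> [[oU loc]|[oU pc pN]].
  split=> // [i|u Uu]; last first.
    have [V [oV Vu VU [N [pN _]]]] := loc _ Uu; exists N.
    have : \forall v \near u, V v by exact: open_nbhs_nbhs.
    apply: filterS => v Vv; apply/leq_sizeP => i Ni.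
    by rewrite coef_poly_of_seq pN//; exact: mem_set.
  apply: smooth_on_local => u Uu.
  have [V [oV Vu VU [N [pN ps]]]] := loc _ Uu; exists V; split=> //.
  have [Ni|iN] := leqP N i.
    apply: (smooth_on_ext (f := cst 0)) => //; last by move=> k; exact: Ck_cst.
    by move=> v Vv; rewrite /= coef_poly_of_seq pN.
  move=> k; have := @Ck_mx _ _ _ _ _ _ _ ord0 (Ordinal iN) oV (ps k).
  by apply: Ck_ext => // v _; rewrite mxE coef_poly_of_seq.
split=> // u Uu; have [N uN] := pN _ Uu.
have [V [oV Vu VU VN]] := near_open_sub oU Uu uN.
exists V; split=> //; exists N; split.
  move=> v /set_mem/VN /= vN i Ni.
  by rewrite -coef_poly_of_seq nth_default// (leq_trans vN).
move=> k; apply: Ck_rV => // j.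
apply: (@Ck_ext _ _ _ _ _ (fun v => (poly_of_seq (p v))`_j)) => //.
  by move=> v _; rewrite mxE coef_poly_of_seq.
by apply: Ck_sub (pc j k).
Qed.

Lemma poly_plotP m (U : set 'rV[R]_m) (q : 'rV[R]_m -> {poly R}) :
  plot U (fun u => seq_of_poly (q u)) <-> poly_plot U q.
Proof.
suff {2}-> : q = poly_of_seq \o (fun u => seq_of_poly (q u)).
  exact: Rinfty_plotP.
by apply/funext => u /=; rewrite seq_of_polyK.
Qed.

(** * Closure properties of [poly_plot] *)

Lemma poly_plot_cst m (U : set 'rV[R]_m) q : open U -> poly_plot U (fun=> q).
Proof. by move=> oU; apply/poly_plotP; exact: (plot_cst (Defs.diffP _)). Qed.

Lemma poly_plot_local m (U : set 'rV[R]_m) (q : 'rV[R]_m -> {poly R}) :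
  (forall u, U u -> exists V, [/\ V u, V `<=` U & poly_plot V q]) ->
  poly_plot U q.
Proof.
move=> loc; apply/poly_plotP; apply: (plot_local (Defs.diffP _)) => u Uu.
by have [V [Vu VU /poly_plotP Vq]] := loc _ Uu; exists V.
Qed.

Lemma poly_plot_ext m (U : set 'rV[R]_m) (q r : 'rV[R]_m -> {poly R}) :
  {in U, q =1 r} -> poly_plot U q -> poly_plot U r.
Proof.
move=> qr /poly_plotP qU; apply/poly_plotP.
apply: (plot_eq (Defs.diffP _) _ qU).
by move=> u /qr ->.
Qed.

Lemma poly_plot_comp n m (U : set 'rV[R]_n) (p : 'rV[R]_n -> {poly R})
    (V : set 'rV[R]_m) h :
  poly_plot U p -> open V -> V `<=` h @^-1` U -> smooth_on V h ->
  poly_plot V (p \o h).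
Proof.
move=> /poly_plotP pU oV hV hs; apply/poly_plotP.
exact: (plot_comp (Defs.diffP _) pU).
Qed.

Lemma poly_plotZD m (U : set 'rV[R]_m) (s : 'rV[R]_m -> R)
    (q r : 'rV[R]_m -> {poly R}) :
  smooth_on U s -> poly_plot U q -> poly_plot U r ->
  poly_plot U (fun u => s u *: q u + r u).
Proof.
move=> ss [oU qc qN] [_ rc rN]; split=> // [i k|u Uu].
  apply: Ck_ext (CkD oU (CkM oU (ss k) (qc i k)) (rc i k)) => // u _.
  by rewrite coefD coefZ.
have [[N uN] [N' uN']] := (qN u Uu, rN u Uu).
exists (maxn N N'); apply: filterS2 uN uN' => v vN vN'.
rewrite (leq_trans (size_polyD _ _))// geq_max !leq_max vN' orbT andbT.
by rewrite (leq_trans (size_scale_leq _ _) vN).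
Qed.

Lemma poly_plot_lincomb m (U : set 'rV[R]_m) n (l : 'I_n -> 'rV[R]_m -> R)
    (q : 'I_n -> 'rV[R]_m -> {poly R}) : open U ->
  (forall i, smooth_on U (l i)) -> (forall i, poly_plot U (q i)) ->
  poly_plot U (fun u => \sum_(i < n) l i u *: q i u).
Proof.
move=> oU; elim: n l q => [|n IH] l q ls qs.
  have -> : (fun u => \sum_(i < 0) l i u *: q i u) = fun=> 0.
    by apply/funext => u; rewrite big_ord0.
  exact: poly_plot_cst.
have -> : (fun u => \sum_(i < n.+1) l i u *: q i u) =
    fun u => l ord0 u *: q ord0 u +
      \sum_(i < n) l (lift ord0 i) u *: q (lift ord0 i) u.
  by apply/funext => u; rewrite big_ord_recl.
by apply: poly_plotZD => //; exact: IH.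
Qed.

(** * Coefficient functions and lines in M *)

Lemma dsmooth_coef i : dsmooth (fun f : M => (poly_of f)`_i : RR).
Proof. by move=> n U p /polynomial_plotP[oU pc _]; split=> //; exact: pc. Qed.

Definition coef_map i : 'C^oo(M, RR) := SmoothMap (dsmooth_coef i).

Lemma plot_line x m (U : set 'rV[R]_m) (s : 'rV[R]_m -> R)
    (q : 'rV[R]_m -> {poly R}) :
  smooth_on U s -> poly_plot U q ->
  plot U (fun u => polyfun_of (poly_of x + s u *: q u) : M).
Proof.
move=> ss qU; have [oU _ _] := qU; apply/polynomial_plotP.
have -> : poly_of \o (fun u => polyfun_of (poly_of x + s u *: q u)) =
    fun u => s u *: q u + poly_of x.
  by apply/funext => u /=; rewrite polyfun_ofK addrC.
by apply: poly_plotZD => //; exact: poly_plot_cst.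
Qed.

Lemma dsmooth_line x q :
  dsmooth (fun t : RR => polyfun_of (poly_of x + t *: q) : M).
Proof.
by move=> n U p [oU ps]; apply: plot_line => //; exact: poly_plot_cst.
Qed.

Definition line x q : 'C^oo(RR, M) := SmoothMap (dsmooth_line x q).

Lemma line0 x q : line x q 0 = x.
Proof. by rewrite /= scale0r addr0 poly_ofK. Qed.

Definition line_path x q : paths x := exist _ (line x q) (line0 x q).

Lemma line_path_plot x m (U : set 'rV[R]_m) (q : 'rV[R]_m -> {poly R}) :
  poly_plot U q -> plot U (fun u => line_path x (q u)).
Proof.
move=> qU; have [oU _ _] := qU; split=> // n V h s hV hs [oV ss].
by apply: (@plot_line _ _ _ s (q \o h)) => //; exact: poly_plot_comp qU _ _ _.
Qed.

(** * Tangent vectors of lines, computed in R^N *)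

Definition chart (f : 'C^oo(M, RR)) N (v : 'rV[R]_N) : R :=
  f (polyfun_of (rVpoly v)).

(** The inclusion of R^N is a plot of M, its coefficients being coordinates or zero, and [f] carries
    plots to smooth functions. *)
Lemma smooth_chart f N : smooth_on setT (@chart f N).
Proof.
have [] // : real_plot setT (@chart f N).
apply: (smooth_mapP f (p := fun v : 'rV[R]_N => polyfun_of (rVpoly v) : M)).
apply/polynomial_plotP.
have -> : poly_of \o (fun v : 'rV[R]_N => polyfun_of (rVpoly v)) = rVpoly.
  by apply/funext => v /=; rewrite polyfun_ofK.
split=> [|i k|v _]; first exact: openT; last first.
  by exists N; apply: (@nearW _ (nbhs v)) => w; exact: size_poly.
case: (insubP 'I_N i) => [j _ ij|Ni].
  apply: (@Ck_ext _ _ _ _ _ (fun v : 'rV[R]_N => v 0 j)).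
  - exact: openT.
  - by move=> v _; rewrite -ij coef_rVpoly_ord.
  - by apply: Ck_mx; [exact: openT|exact: Ck_id].
apply: (@Ck_ext _ _ _ _ _ (cst 0)); [exact: openT| |exact: Ck_cst].
by move=> v _; rewrite coef_rVpoly insubN.
Qed.

(** The line is affine in R^N, so differentiating along it is a directional derivative of
    [chart f N]. *)
Lemma tangent_vector_line x q f N :
  (size (poly_of x) <= N)%N -> (size q <= N)%N ->
  tangent_vector (line x q) f =
  'd (@chart f N) (poly_rV (poly_of x)) (poly_rV q).
Proof.
move=> xN qN; rewrite -deriveE; last first.
  by have [+ _] := @smooth_chart f N 1; apply; rewrite in_setT.
rewrite /tangent_vector; apply: derive1_line => t.
rewrite /chart linearD linearZ /= !poly_rV_K//.
by rewrite addrC.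
Qed.

Lemma coef_tangent_vector_line x q i :
  tangent_vector (line x q) (coef_map i) = q`_i.
Proof.
rewrite /tangent_vector (@derive1_line _ _ id (poly_of x)`_i q`_i).
  by rewrite deriveE// diff_val.
by move=> t /=; rewrite polyfun_ofK coefD coefZ addrC.
Qed.

(** One N bounds all the sizes, and the differential of [chart f N] is linear. *)
Lemma tangent_vector_lincomb x n (l : 'I_n -> R) (q : 'I_n -> {poly R}) f :
  tangent_vector (line x (\sum_(i < n) l i *: q i)) f =
  \sum_(i < n) l i * tangent_vector (line x (q i)) f.
Proof.
pose N := maxn (size (poly_of x)) (\max_(i < n) size (q i)).
have xN : (size (poly_of x) <= N)%N by rewrite leq_maxl.
have qN i : (size (q i) <= N)%N.
  by rewrite leq_max (leq_bigmax i) orbT.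
rewrite (@tangent_vector_line _ _ _ N)//; last first.
  apply: (leq_trans (size_sum _ _ _)); apply/bigmax_leqP => i _.
  exact: leq_trans (size_scale_leq _ _) (qN i).
rewrite !linear_sum; apply: eq_bigr => i _.
by rewrite !linearZ (@tangent_vector_line _ _ _ N).
Qed.

(** * Velocities of arbitrary paths and of plots of paths *)

Lemma tangent_vector_path x (a : 'C^oo(RR, M)) : a 0 = x ->
  exists q, tangent_vector a = tangent_vector (line x q).
Proof.
(* Time is encoded as a row of length 1, since plots are defined on rows. *)
move=> a0; pose P (w : 'rV[R]_1) : M := a (w 0 0).
have /polynomial_plotP[_ Pc PN] : plot setT P.
  apply: (smooth_mapP a (p := fun w : 'rV[R]_1 => w 0 0)); split.
    exact: openT.
  by move=> k; apply: Ck_mx; [exact: openT|exact: Ck_id].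
have [N zN] := PN 0 I.
have P0 : P 0 = x by rewrite /P mxE.
have xN : (size (poly_of x) <= N)%N by rewrite -P0; exact: nbhs_singleton zN.
pose A (w : 'rV[R]_1) : 'rV[R]_N := poly_rV (poly_of (P w)).
have As : smooth_on setT A.
  move=> k; apply: Ck_rV; first exact: openT.
  move=> j; apply: Ck_ext (Pc j k); first exact: openT.
  by move=> w _; rewrite mxE.
have dA : differentiable A 0.
  by have [+ _] := As 1; apply; rewrite in_setT.
(* The direction is the time derivative at 0 of the coefficient row, [const_mx 1] being the unit
   vector of the time axis. *)
exists (rVpoly ('d A 0 (const_mx 1))); apply/funext => f.
have dF : differentiable (@chart f N) (A 0).
  by have [+ _] := @smooth_chart f N 1; apply; rewrite in_setT.
rewrite (@tangent_vector_line _ _ _ N) ?size_poly// rVpolyK.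
rewrite /tangent_vector (@derive1_line _ _ (f \o P) 0 (const_mx 1)); last first.
  by move=> t; rewrite /P /= !mxE mulr1 addr0.
(* Only the germ at 0 counts, and there the path stays in R^N, where [A] describes it. *)
rewrite (@near_eq_derive _ _ _ _ (@chart f N \o A)); last first.
  by apply: filterS zN => w wN; rewrite /chart /A /= poly_rV_K// poly_ofK.
rewrite deriveE; last exact: differentiable_comp.
have A0 : A 0 = poly_rV (poly_of x) by rewrite /A P0.
by rewrite (diff_comp dA dF) A0.
Qed.

(** The coefficients of [q] are the t-derivatives at t = 0 of those of (u, t) |-> a u t, a plot of
    M; differentiation preserves both their smoothness and the local bound on the size. *)
Lemma velocity_plot x m (U : set 'rV[R]_m) (a : 'rV[R]_m -> paths x)
    (q : 'rV[R]_m -> {poly R}) : plot U a ->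
  (forall u i, U u -> (q u)`_i = tangent_vector (sval (a u)) (coef_map i)) ->
  poly_plot U q.
Proof.
move=> [oU aP] qE.
(* A point (u, t) is encoded as [row_mx u t], and [e] is the direction of t. *)
pose V : set 'rV[R]_(m + 1) := setT `&` lsubmx @^-1` U.
have fstS (W : set 'rV[R]_(m + 1)) : open W ->
    smooth_on W (lsubmx : 'rV[R]_(m + 1) -> 'rV[R]_m).
  move=> oW k; apply: Ck_rV => // j.
  apply: (@Ck_ext _ _ _ _ _ (fun w : 'rV[R]_(m + 1) => w 0 (lshift 1 j))) => //.
    by move=> w _; rewrite mxE.
  by apply: Ck_mx => //; exact: Ck_id.
have oV : open V.
  apply: open_preimage; [exact: openT|exact: (fstS _ (@openT _) 0)|exact: oU].
pose P (w : 'rV[R]_(m + 1)) : M := sval (a (lsubmx w)) (w 0 (rshift m 0)).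
have /polynomial_plotP[_ Pc PN] : plot V P.
  apply: (aP _ V lsubmx (fun w => w 0 (rshift m 0))); last split=> // k.
  - by move=> w [].
  - exact: fstS.
  - by apply: Ck_mx => //; exact: Ck_id.
(* [j] embeds [U] at time 0, where the t-derivatives are taken. *)
pose j (u : 'rV[R]_m) : 'rV[R]_(m + 1) := row_mx u 0.
have jS : smooth_on U j.
  move=> k; apply: Ck_rV => // i; case: (split_ordP i) => i' ->.
    apply: (@Ck_ext _ _ _ _ _ (fun u : 'rV[R]_m => u 0 i')) => //.
      by move=> u _; rewrite row_mxEl.
    by apply: Ck_mx => //; exact: Ck_id.
  apply: (@Ck_ext _ _ _ _ _ (cst 0)) => //; last exact: Ck_cst.
  by move=> u _; rewrite row_mxEr mxE.
have jV u : U u -> V (j u) by move=> Uu; split=> //=; rewrite row_mxKl.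
pose e : 'rV[R]_(m + 1) := row_mx 0 (const_mx 1).
pose G i (w : 'rV[R]_(m + 1)) : R := (poly_of (P w))`_i.
have dG i w : V w -> differentiable (G i) w.
  by move=> Vw; have [+ _] := Pc i 1; apply; exact: mem_set.
have qG i u : U u -> (q u)`_i = 'd (G i) (j u) e.
  move=> Uu; rewrite qE// -deriveE; last exact/dG/jV.
  rewrite /tangent_vector; apply: derive1_line => t.
  rewrite /G /P /e /j scale_row_mx add_row_mx row_mxKl scaler0 add0r row_mxEr.
  by rewrite !mxE mulr1 addr0.
split=> // [i|u Uu].
  apply: (smooth_on_ext (f := (fun w => 'd (G i) w e) \o j)) => //.
    by move=> u /set_mem Uu; rewrite qG.
  apply: (smooth_on_comp (U' := V)) => //.
  by apply: smooth_on_diff; exact: Pc.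
have [N wN] := PN _ (jV _ Uu); exists N.
have [W [oW Wu WV WN]] := near_open_sub oV (jV _ Uu) wN.
have : \forall v \near u, (U `&` j @^-1` W) v.
  apply: open_nbhs_nbhs; split=> //.
  by apply: open_preimage => //; exact: (jS 0).
apply: filterS => v [Uv Wv]; apply/leq_sizeP => i Ni.
rewrite qG//.
(* A coefficient of index at least N vanishes on a whole neighbourhood of [j v], hence so does its
   differential there. *)
have G0 : \forall w \near j v, cst 0 w = G i w.
  have : \forall w \near j v, W w by exact: open_nbhs_nbhs.
  apply: filterS => w /WN /= wN'.
  by rewrite /G nth_default// (leq_trans wN').
have [_ ->] := near_eq_diff G0 (differentiable_cst _ _).
by rewrite diff_cst.
Qed.

(** * The tangent cone and the tangent space identified with R^oo *)

Section TangentCone.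
Variable x : M.
Local Notation C := (tangent_cone x).
Local Notation T := (tangent_space x).

(** At most one polynomial qualifies; functionals for which none does get the default 0. *)
Definition velocity (phi : tangent_functional M) : {poly R} :=
  xget 0 [set q : {poly R} | forall i, q`_i = phi (coef_map i)].

Lemma velocity_line q : velocity (tangent_vector (line x q)) = q.
Proof.
apply: xget_unique => [i|r rE]; first by rewrite coef_tangent_vector_line.
by apply/polyP => i; rewrite rE coef_tangent_vector_line.
Qed.

(** A cone vector comes from a path, hence from a line, whose direction [velocity] recovers. *)
Lemma cone_vectorE (c : C) :
  sval c = tangent_vector (line x (velocity (sval c))).
Proof.
case: c => phi /= [c ->].
have [q qE] := tangent_vector_path (svalP (repr c : paths x)).
by rewrite /class_vector qE velocity_line.
Qed.

Lemma space_lincombE n (l : 'I_n -> R) (c : 'I_n -> C) :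
  (fun f => \sum_(i < n) l i * sval (c i) f) =
  tangent_vector (line x (\sum_(i < n) l i *: velocity (sval (c i)))).
Proof.
apply/funext => f; rewrite tangent_vector_lincomb.
by apply: eq_bigr => i _; rewrite -cone_vectorE.
Qed.

(** A combination of cone vectors is again the tangent vector of a line, so the span adds nothing to
    the cone. *)
Lemma space_vectorE (v : T) :
  sval v = tangent_vector (line x (velocity (sval v))).
Proof.
case: v => phi /= [n [l [c ->]]].
by rewrite space_lincombE velocity_line.
Qed.

Lemma line_vector_in_cone q :
  exists c : path_classes x, tangent_vector (line x q) = class_vector c.
Proof.
exists (\pi_({eq_quot (tangent_equiv x)})
  (line_path x q : {classic paths x}))%qT.
by rewrite class_vectorE.
Qed.

Definition cone_vector q : C := exist _ _ (line_vector_in_cone q).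

(** The lines themselves give a lift to paths on all of [U]. *)
Lemma cone_vector_plot m (U : set 'rV[R]_m) (q : 'rV[R]_m -> {poly R}) :
  poly_plot U q -> plot U (fun u => cone_vector (q u)).
Proof.
move=> qU; have [oU _ _] := qU; split=> // u Uu; exists U; split=> //.
exists (fun u => \pi_({eq_quot (tangent_equiv x)})
  (line_path x (q u) : {classic paths x}))%qT.
split; last by move=> v _; rewrite class_vectorE.
split=> // v Uv; exists U; split=> //.
by exists (fun u => line_path x (q u)); split=> //; exact: line_path_plot.
Qed.

Lemma cone_velocity_plot m (U : set 'rV[R]_m) (c : 'rV[R]_m -> C) :
  plot U c -> poly_plot U (fun u => velocity (sval (c u))).
Proof.
move=> [oU loc]; apply: poly_plot_local => u Uu.
(* Two localisations: a cone plot lifts to path classes on [V], and these lift to paths on [W]. *)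
have [V [oV Vu VU [k [[_ kloc] kE]]]] := loc _ Uu.
have [W [oW Wu WV [a [aW aE]]]] := kloc _ Vu.
exists W; split=> //; first exact: subset_trans VU.
apply: velocity_plot aW _ => v i Wv.
have -> : tangent_vector (sval (a v)) = sval (c v).
  rewrite kE; last exact/mem_set/WV.
  by rewrite aE ?class_vectorE//; exact: mem_set.
by rewrite {2}cone_vectorE coef_tangent_vector_line.
Qed.

Lemma space_velocity_plot m (U : set 'rV[R]_m) (p : 'rV[R]_m -> T) :
  plot U p -> poly_plot U (fun u => velocity (sval (p u))).
Proof.
move=> [oU loc]; apply: poly_plot_local => u Uu.
have [V [oV Vu VU [n [l [c [ls cs pE]]]]]] := loc _ Uu.
exists V; split=> //.
apply: (@poly_plot_ext _ _
  (fun u => \sum_(i < n) l i u *: velocity (sval (c i u)))).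
  by move=> v /pE ->; rewrite space_lincombE velocity_line.
by apply: poly_plot_lincomb => // i; exact: cone_velocity_plot.
Qed.

Lemma cone_in_space (c : C) : exists n (l : 'I_n -> R) (d : 'I_n -> C),
  sval c = fun f => \sum_(i < n) l i * sval (d i) f.
Proof.
exists 1, (fun=> 1), (fun=> c); apply/funext => f.
by rewrite big_ord1 mul1r.
Qed.

Definition space_of_cone (c : C) : T := exist _ _ (cone_in_space c).

Definition cone_of_space (v : T) : C := cone_vector (velocity (sval v)).

Definition Rinfty_of_cone (c : C) : Rinfty R := seq_of_poly (velocity (sval c)).

Definition cone_of_Rinfty (s : Rinfty R) : C := cone_vector (poly_of_seq s).

Lemma dsmooth_space_of_cone : dsmooth space_of_cone.
Proof.
move=> m U c cU; have oU := plot_open (Defs.diffP C) cU.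
split=> // u Uu; exists U; split=> //.
exists 1, (fun _ _ => 1), (fun _ => c); split=> // [_ k|v _].
  exact: Ck_cst.
by apply/funext => f /=; rewrite big_ord1 mul1r.
Qed.

Lemma dsmooth_cone_of_space : dsmooth cone_of_space.
Proof. by move=> m U p pU; exact/cone_vector_plot/space_velocity_plot. Qed.

Lemma dsmooth_Rinfty_of_cone : dsmooth Rinfty_of_cone.
Proof. by move=> m U p pU; exact/poly_plotP/cone_velocity_plot. Qed.

Lemma dsmooth_cone_of_Rinfty : dsmooth cone_of_Rinfty.
Proof. by move=> m U s /Rinfty_plotP sU; exact/cone_vector_plot. Qed.

End TangentCone.

End PolynomialSpace.

Theorem theorem4p12 (R : realType) (x : polynomial_space R) :
  diffeomorphic (tangent_space x) (tangent_cone x) /\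
  diffeomorphic (tangent_cone x) (Rinfty R).
Proof.
split.
  exists (SmoothMap (@dsmooth_cone_of_space R x)).
  exists (SmoothMap (@dsmooth_space_of_cone R x)).
  (* Both composites replace a functional by the tangent vector of the line along its velocity,
     which is the same functional. *)
  split=> [[phi phiP]|[phi phiP]]; apply: eq_exist => /=.
    by rewrite -(space_vectorE (exist _ phi phiP)).
  by rewrite -(cone_vectorE (exist _ phi phiP)).
exists (SmoothMap (@dsmooth_Rinfty_of_cone R x)).
exists (SmoothMap (@dsmooth_cone_of_Rinfty R x)).
split=> [[phi phiP]|s] /=.
  apply: eq_exist; rewrite seq_of_polyK.
  by rewrite -(cone_vectorE (exist _ phi phiP)).
by rewrite /Rinfty_of_cone /= velocity_line poly_of_seqK.
Qed.
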